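(* Let $1<a\le b\le2$, let $\alpha:\mathbf{R}\to[a,b]$ be continuous, let $0<H<1$ with $Ha>1$, let $\lambda>0$, and let $X_{H,\alpha(x),\lambda}$ be the linear tempered fractional multistable motion. Then for any $0<\beta<H-1/a$, the process $X_{H,\alpha(x),\lambda}(t)$, $t\in\mathbf{R}$, has a continuous version whose paths are almost surely $\beta$-Hölder continuous on each bounded interval.
   Context: Conventions: $(x)_+=\max\{x,0\}$ and $0^\gamma=0$ for all $\gamma\in\mathbf{R}$. Set $$G_{H,\alpha(x),\lambda}(t,x)=e^{-\lambda(t-x)_+}(t-x)_+^{H-\frac1{\alpha(x)}}-e^{-\lambda(-x)_+}(-x)_+^{H-\frac1{\alpha(x)}} .$$ The multistable stochastic integral $I(f)=\int f(x)\,dM_\alpha(x)$, defined for measurable $f$ with $\int_{-\infty}^\infty|f(x)|^{\alpha(x)}dx<\infty$, is specified by its finite-dimensional distributions: $\mathbf{E}[e^{i\sum_{k=1}^d\theta_kI(f_k)}]=\exp\{-\int_{-\infty}^\infty|\sum_{k=1}^d\theta_kf_k(x)|^{\alpha(x)}dx\}$. The linear tempered fractional multistable motion (LTFmSM) is $X_{H,\alpha(x),\lambda}(t)=\int_{-\infty}^\infty G_{H,\alpha(x),\lambda}(t,x)\,dM_\alpha(x)$, $t\in\mathbf{R}$; thus $$\mathbf{E}\Big[e^{i\sum_{k=1}^d\theta_kX_{H,\alpha(x),\lambda}(t_k)}\Big]=\exp\Big\{-\int_{-\infty}^\infty\Big|\sum_{k=1}^d\theta_kG_{H,\alpha(x),\lambda}(t_k,x)\Big|^{\alpha(x)}dx\Big\}.$$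 *)

(* Defs.v *)
From mathcomp Require Import all_boot all_order all_algebra.
From mathcomp Require Import all_classical all_reals all_analysis.
From mathcomp Require Import complex.

Set Implicit Arguments.
Unset Strict Implicit.
Unset Printing Implicit Defensive.

Import Order.TTheory GRing.Theory Num.Theory.
Import numFieldNormedType.Exports.

Local Open Scope classical_set_scope.
Local Open Scope ring_scope.

(* (x)_+ ^ g with the convention 0 ^ g = 0 for every real g; the case split is
   needed because the library has 0 `^ 0 = 1. *)
Definition ppow (R : realType) (x g : R) : R :=
  if 0 < x then x `^ g else 0.

Definition tempered_kernel (R : realType) (H : R) (alpha : R -> R) (lambda : R)
    (t x : R) : R :=
  expR (- lambda * Num.max (t - x) 0) * ppow (t - x) (H - (alpha x)^-1)
  - expR (- lambda * Num.max (- x) 0) * ppow (- x) (H - (alpha x)^-1).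

(* E[e^{iY}], as E[cos Y] + i E[sin Y]; both integrands are bounded, so for a
   random variable Y the expectations are finite and [fine] loses nothing. *)
Definition expect_expi (d : measure_display) (T : measurableType d)
    (R : realType) (P : probability T R) (Y : T -> R) : R[i] :=
  Complex (fine ('E_P[(fun w => cos (Y w))])%E)
          (fine ('E_P[(fun w => sin (Y w))])%E).

Definition multistable_integrable (R : realType) (alpha f : R -> R) : Prop :=
  measurable_fun [set: R] f /\
  (\int[lebesgue_measure]_x (`|f x| `^ alpha x)%:E < +oo)%E.

(* The stochastic integral is the process f |-> I f on the class of integrable
   functions, specified through its finite-dimensional distributions; the
   values of I outside that class are unconstrained. *)
Definition is_multistable_integral (d : measure_display) (T : measurableType d)
    (R : realType) (P : probability T R) (alpha : R -> R)
    (I : (R -> R) -> {RV P >-> R}) : Prop :=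
  forall (n : nat) (theta : 'I_n -> R) (f : 'I_n -> R -> R),
    (forall k, multistable_integrable alpha (f k)) ->
    expect_expi P (fun w => \sum_(k < n) theta k * I (f k) w) =
    (expR (- (\int[lebesgue_measure]_x
                (`|\sum_(k < n) theta k * f k x| `^ alpha x))))%:C%C.

Definition LTFmSM (d : measure_display) (T : measurableType d)
    (R : realType) (P : probability T R) (I : (R -> R) -> {RV P >-> R})
    (H : R) (alpha : R -> R) (lambda : R) : R -> {RV P >-> R} :=
  fun t => I (tempered_kernel H alpha lambda t).

Definition is_version (d : measure_display) (T : measurableType d)
    (R : realType) (P : probability T R) (X Y : R -> {RV P >-> R}) : Prop :=
  forall t : R, {ae P, forall w, Y t w = X t w}.

Definition holder_on (R : realType) (beta : R) (A : set R) (g : R -> R) : Prop :=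
  exists C : R, forall s t : R, A s -> A t ->
    `|g s - g t| <= C * `|s - t| `^ beta.

(* Main.v *)
Require Import Defs.
From HB Require Import structures.
From mathcomp Require Import all_boot all_order all_algebra.
From mathcomp Require Import all_classical all_reals all_analysis.
From mathcomp Require Import measurable_realfun zify ring lra.
Set Implicit Arguments.
Unset Strict Implicit.
Unset Printing Implicit Defensive.
Import Order.TTheory GRing.Theory Num.Theory.
Import numFieldNormedType.Exports.
Local Open Scope classical_set_scope.
Local Open Scope ring_scope.

(** For [s < t = s + h] the kernel increment vanishes for [x >= t], is at most
    [(2h)^(H - 1/alpha x)] for [s - h < x < t], and at most
    [h (s - x)^(H - 1/alpha x - 1)] for [x <= s - h].  Hence the integral of
    [`|c (G_t - G_s)|^alpha] is at most a constant times the largest value of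
    [c^p h^(H p)], [a <= p <= b].  Through the characteristic function of
    [X_t - X_s] this gives, for [h <= 1],
    [P(`|X_t - X_s| > h^beta) <= C h^((H - beta) a)], and the exponent exceeds 1
    exactly because [beta < H - 1/a].  By Borel-Cantelli this tail bound controls
    all small dyadic increments, and the version is the limit of [X] along dyadic
    approximations of [t] from below. *)

(** * Increments of the tempered kernel *)

(** The common profile of the two kernel terms. The term taken at [- x] does not depend on [t], so
    it cancels in every increment. *)
Definition tempered_power (R : realType) (lambda g u : R) : R :=
  expR (- lambda * Num.max u 0) * ppow u g.

Lemma tempered_kernelE (R : realType) (H lambda : R) (alpha : R -> R) (t x : R) :
  tempered_kernel H alpha lambda t x =
  tempered_power lambda (H - (alpha x)^-1) (t - x)
  - tempered_power lambda (H - (alpha x)^-1) (- x).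
Proof. by []. Qed.

Lemma ppow_ge0 (R : realType) (u g : R) : 0 <= ppow u g.
Proof. by rewrite /ppow; case: ifP => // _; exact: powR_ge0. Qed.

Lemma tempered_power_ge0 (R : realType) (lambda g u : R) :
  0 <= tempered_power lambda g u.
Proof. by rewrite mulr_ge0 ?expR_ge0 ?ppow_ge0. Qed.

Lemma tempered_power_npos (R : realType) (lambda g u : R) :
  u <= 0 -> tempered_power lambda g u = 0.
Proof. by move=> u0; rewrite /tempered_power /ppow ltNge u0 mulr0. Qed.

Lemma tempered_power_pos (R : realType) (lambda g u : R) :
  0 < u -> tempered_power lambda g u = expR (- lambda * u) * u `^ g.
Proof.
by move=> u0; rewrite /tempered_power /ppow u0 (max_l (ltW u0)).
Qed.

Lemma tempered_power_le (R : realType) (lambda g u v : R) :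
  0 <= lambda -> 0 <= g -> u <= v -> 0 < v -> tempered_power lambda g u <= v `^ g.
Proof.
move=> l0 g0 uv v0; have [u0|u0] := leP u 0.
  by rewrite tempered_power_npos// powR_ge0.
rewrite tempered_power_pos// -[leRHS]mul1r ler_pM ?expR_ge0 ?powR_ge0//.
  by rewrite -expR0 ler_expR mulNr oppr_le0 mulr_ge0// ltW.
by rewrite ge0_ler_powR// nnegrE ltW.
Qed.

(* Upwards the exponential factor only helps and concavity of the power gives
   the bound; downwards, [lambda v e^{- lambda v} <= 1]. *)
Lemma tempered_power_incr (R : realType) (lambda g v h : R) :
  0 <= lambda -> 0 <= g <= 1 -> 0 < v -> 0 <= h ->
  `|tempered_power lambda g (v + h) - tempered_power lambda g v|
  <= h * v `^ (g - 1).
Proof.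
move=> l0 /andP[g0 g1] v0 h0; have vh0 : 0 < v + h by lra.
rewrite !tempered_power_pos//.
have pE : v `^ g = v * v `^ (g - 1).
  by rewrite -{2}[v]powRr1 ?ltW// -powRD ?(gt_eqF v0) ?implybT//; congr powR; ring.
have q0 : 0 <= v `^ (g - 1) by exact: powR_ge0.
(* Since [1 + h / v >= 1] and [g <= 1], the power of this ratio is at most the ratio itself. *)
have qE : (v + h) `^ g <= v `^ g + h * v `^ (g - 1).
  have -> : v + h = v * (1 + h / v) by field; rewrite gt_eqF.
  have hv : 0 <= h / v by rewrite divr_ge0// ltW.
  rewrite (powRM _ (ltW v0)); last by lra.
  apply: (@le_trans _ _ (v `^ g * (1 + h / v))).
    by rewrite ler_wpM2l ?powR_ge0// ler1_powR//; lra.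
  rewrite mulrDr mulr1 lerD2l pE.
  have -> : v * v `^ (g - 1) * (h / v) = h * v `^ (g - 1).
    by field; rewrite gt_eqF.
  exact: lexx.
have e1 : expR (- lambda * (v + h)) <= expR (- lambda * v).
  by rewrite ler_expR !mulNr lerN2 ler_wpM2l// lerDl.
have e2 : expR (- lambda * v) <= 1.
  by rewrite -expR0 ler_expR mulNr oppr_le0 mulr_ge0// ltW.
have e3 : expR (- lambda * v) * (1 - lambda * h) <= expR (- lambda * (v + h)).
  rewrite [X in _ <= expR X]mulrDr expRD ler_wpM2l ?expR_ge0//.
  by have := expR_ge1Dx (- lambda * h); lra.
have e4 : expR (- lambda * v) * (lambda * v) <= 1.
  rewrite mulNr expRN mulrC ler_pdivrMr ?expR_gt0// mul1r.
  by have := expR_ge1Dx (lambda * v); lra.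
have p1 : v `^ g <= (v + h) `^ g.
  by rewrite ge0_ler_powR// ?nnegrE; lra.
have E0 := expR_ge0 (- lambda * v); have E0' := expR_ge0 (- lambda * (v + h)).
have p0 : 0 <= v `^ g by exact: powR_ge0.
have p0' : 0 <= (v + h) `^ g by exact: powR_ge0.
rewrite ler_norml; apply/andP; split.
  (* The power grows, so only the loss in the exponential factor counts. It is at most [lambda * h]
     times the old factor, and [pE] supplies the [v] that turns this into [e4]. *)
  rewrite lerNl opprB.
  apply: (@le_trans _ _ (expR (- lambda * v) * v `^ g
                         - expR (- lambda * (v + h)) * v `^ g)).
    by rewrite lerD2l lerN2 ler_wpM2l.
  rewrite -mulrBl.
  apply: (@le_trans _ _ (expR (- lambda * v) * (lambda * h) * v `^ g)).
    by rewrite ler_wpM2r//; lra.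
  rewrite pE.
  have -> : expR (- lambda * v) * (lambda * h) * (v * v `^ (g - 1)) =
    (expR (- lambda * v) * (lambda * v)) * (h * v `^ (g - 1)) by ring.
  by rewrite -[leRHS]mul1r ler_wpM2r// mulr_ge0.
apply: (@le_trans _ _ (expR (- lambda * v) * ((v + h) `^ g - v `^ g))).
  by rewrite mulrBr lerD2r ler_wpM2r.
rewrite -[leRHS]mul1r ler_pM ?subr_ge0//.
by rewrite lerBlDl.
Qed.

(** As [(H - p^-1) * p = H * p - 1], the power produces [c ^ p * h ^ (H * p) / h] and a factor
    [2 ^ (H * p - 1) <= 2]. The [1 / h] will cancel against the length of the window around [s]. *)
Lemma powR_near_bound (R : realType) (H p c h M D : R) :
  0 < p -> 1 <= H * p <= 2 -> 0 <= c -> 0 < h ->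
  c `^ p * h `^ (H * p) <= M -> 0 <= D -> D <= (2 * h) `^ (H - p^-1) ->
  (c * D) `^ p <= 2 * M / h.
Proof.
move=> p0 /andP[Hp1 Hp2] c0 h0 cM D0 DB.
have pn0 : p != 0 by rewrite gt_eqF.
apply: (@le_trans _ _ ((c * (2 * h) `^ (H - p^-1)) `^ p)).
  by rewrite (ge0_ler_powR (ltW p0))// ?nnegrE ?mulr_ge0 ?powR_ge0// ler_wpM2l.
rewrite powRM ?powR_ge0// -powRrM.
have -> : (H - p^-1) * p = H * p - 1 by field.
rewrite (powRM _ _ (ltW h0))// (powRB (r := H * p) (x := h)); last first.
  by rewrite (gt_eqF h0) implybT.
rewrite powRr1 ?(ltW h0)//.
have e2 : (2 : R) `^ (H * p - 1) <= 2 by rewrite ler1_powR//; lra.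
have -> : c `^ p * (2 `^ (H * p - 1) * (h `^ (H * p) / h)) =
  2 `^ (H * p - 1) * ((c `^ p * h `^ (H * p)) / h) by ring.
rewrite -[leRHS]mulrA ler_pM ?powR_ge0// ?divr_ge0 ?mulr_ge0 ?powR_ge0// ?(ltW h0)//.
by rewrite ler_pM2r ?invr_gt0.
Qed.

(** The exponent of [v] in the bound is free of [p], so it can be integrated while [p = alpha x]
    varies. Beyond [c ^ p * h ^ (H * p)], the dependence on [p] collects in
    [(h / v) ^ ((p - 1) * (1 - H))], at most 1 because [h <= v]. *)
Lemma powR_far_bound (R : realType) (H p c h v M D : R) :
  1 <= p -> H <= 1 -> 0 <= c -> 0 < h -> h <= v ->
  c `^ p * h `^ (H * p) <= M -> 0 <= D -> D <= h * v `^ (H - p^-1 - 1) ->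
  (c * D) `^ p <= M * (h `^ (1 - H) * v `^ (H - 2)).
Proof.
move=> p1 H1 c0 h0 hv cM D0 DB.
have p0 : 0 < p by lra.
have v0 : 0 < v by lra.
have pn0 : p != 0 by rewrite gt_eqF.
have hn (r s : R) : (r + s == 0) ==> (h != 0) by rewrite (gt_eqF h0) implybT.
have vn (r s : R) : (r + s == 0) ==> (v != 0) by rewrite (gt_eqF v0) implybT.
apply: (@le_trans _ _ ((c * (h * v `^ (H - p^-1 - 1))) `^ p)).
  rewrite (ge0_ler_powR (ltW p0))// ?nnegrE ?mulr_ge0 ?powR_ge0// ?(ltW h0)//.
  by rewrite ler_wpM2l.
rewrite (powRM _ c0) ?mulr_ge0 ?powR_ge0 ?(ltW h0)//.
rewrite (powRM _ (ltW h0)) ?powR_ge0// -powRrM.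
have -> : (H - p^-1 - 1) * p = (H - 2) + - ((p - 1) * (1 - H)) by field.
have -> : h `^ p = h `^ (H * p) * (h `^ (1 - H) * h `^ ((p - 1) * (1 - H))).
  by rewrite -!(powRD (hn _ _)); congr (h `^ _); ring.
rewrite (powRD (vn _ _)) powRN.
have -> : c `^ p * (h `^ (H * p) * (h `^ (1 - H) * h `^ ((p - 1) * (1 - H))) *
   (v `^ (H - 2) / v `^ ((p - 1) * (1 - H)))) =
  (c `^ p * h `^ (H * p)) * ((h `^ (1 - H) * v `^ (H - 2)) *
  (h `^ ((p - 1) * (1 - H)) / v `^ ((p - 1) * (1 - H)))) by ring.
rewrite ler_pM ?mulr_ge0 ?invr_ge0 ?powR_ge0// ler_piMr ?mulr_ge0 ?powR_ge0//.
rewrite ler_pdivrMr ?powR_gt0// mul1r ge0_ler_powR ?nnegrE ?(ltW h0) ?(ltW v0)//.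
by rewrite mulr_ge0//; lra.
Qed.

Lemma measurable_fun_powR2 d (T : measurableType d) (R : realType)
    (f g : T -> R) : measurable_fun setT f -> measurable_fun setT g ->
  measurable_fun setT (fun x => f x `^ g x).
Proof.
move=> mf mg; rewrite /powR; apply: measurable_fun_ifT.
- exact: measurable_fun_eqr.
- by apply: measurableT_comp => //; exact: measurable_fun_eqr.
- apply: measurableT_comp => //; apply: measurable_funM => //.
  exact: measurableT_comp.
Qed.

Lemma powR_cvgy0 (R : realType) (q : R) :
  0 < q -> (fun x : R => x `^ (- q)) @ +oo --> (0 : R).
Proof.
move=> q0.
have H : (fun x : R => expR (- (q * ln x))) @ +oo --> (0 : R).
  apply: (@cvg_comp _ _ _ (fun x : R => q * ln x) (fun y => expR (- y)) _ (pinfty_nbhs R)).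
    apply: gt0_cvgMry => //; apply/cvgryPge => y; near=> x.
    by rewrite -ler_expR lnK// posrE.
  exact: cvgr_expR.
apply: cvg_trans H; apply: near_eq_cvg; near=> x.
by rewrite /powR gt_eqF ?mulNr.
Unshelve. all: by end_near. Qed.

(** Reflection in the origin moves the integral to [[h - s, +oo[], where [- (s + x) ^ (- q) / q] is
    an antiderivative that vanishes at infinity. *)
Lemma integral_powR_tail (R : realType) (s h q : R) : 0 < h -> 0 < q ->
  (\int[lebesgue_measure]_(x in `]-oo, (s - h)%R])
     ((s - x) `^ (- q - 1))%:E = (h `^ (- q) / q)%:E)%E.
Proof.
move=> h0 q0.
have -> : s - h = - (h - s) by ring.
rewrite ge0_integration_by_substitutionNy; last 2 first.
- apply: continuous_in_subspaceT => x; rewrite inE/= in_itv/= => xs.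
  apply: (@continuous_comp _ _ _ (fun x : R => s - x) (fun y => y `^ (- q - 1))).
    by apply: continuousB; [exact: cvg_cst|exact: cvg_id].
  apply: differentiable_continuous; apply/derivable1_diffP.
  by apply: derivable_powR; rewrite in_itv/= andbT; lra.
- by move=> x _; exact: powR_ge0.
have dF (x : R) : h - s <= x ->
    is_derive x 1 (fun x : R => - q^-1 * (s + x) `^ (- q)) ((s + x) `^ (- q - 1)).
  move=> hx; have sx : 0 < s + x by lra.
  have d1 : is_derive x (1 : R) (fun x : R => s + x) 1.
    by rewrite -[X in is_derive _ _ _ X]add0r; exact: is_deriveD.
  have d2 := is_derive1_comp (is_derive1_powR (- q) sx) d1.
  have := is_deriveZ (- q^-1) d2.
  rewrite mulr1 (_ : - q^-1 *: _ = (s + x) `^ (- q - 1))//.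
  by rewrite -[LHS]/(_ * _) mulrA mulrNN mulVf ?mul1r// gt_eqF.
rewrite (@ge0_continuous_FTC2y _ _ (fun x : R => - q^-1 * (s + x) `^ (- q)) _ 0).
- by rewrite -EFinB; congr (_%:E); rewrite (_ : s + (h - s) = h); ring.
- by move=> x _; exact: powR_ge0.
- apply: continuous_in_subspaceT => x; rewrite inE/= in_itv/= andbT => xs.
  apply: (@continuous_comp _ _ _ (fun x : R => s - - x) (fun y => y `^ (- q - 1))).
    by apply: cvgB; [exact: cvg_cst|apply: cvgN; exact: cvg_id].
  apply: differentiable_continuous; apply/derivable1_diffP.
  by apply: derivable_powR; rewrite in_itv/= andbT; lra.
- rewrite -[X in _ --> X](mulr0 (- q^-1)); apply: cvgM; first exact: cvg_cst.
  apply: (@cvg_comp _ _ _ (fun x : R => s + x) (fun y => y `^ (- q)) _ (pinfty_nbhs R)).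
    by apply/cvgryPge => y; near=> x; rewrite -lerBlDl.
  exact: powR_cvgy0.
- by move=> x /ltW hx; have [] := dF _ hx.
- have [/derivable1_diffP/differentiable_continuous cF _] := dF _ (lexx (h - s)).
  exact: cvg_at_right_filter.
- move=> x; rewrite in_itv/= andbT => hx.
  by rewrite derive1E; have [_ ->] := dF _ (ltW hx); rewrite /= opprK.
Unshelve. all: by end_near. Qed.

Lemma measurable_tempered_kernel (R : realType) (H : R) (alpha : R -> R) (lambda t : R) :
  (forall x, alpha x != 0) -> continuous alpha ->
  measurable_fun setT (tempered_kernel H alpha lambda t).
Proof.
move=> a0 ca.
have mg : measurable_fun setT (fun x : R => H - (alpha x)^-1).
  apply: continuous_measurable_fun => x; apply: cvgB; first exact: cvg_cst.
  by apply: cvgV => //; exact: ca.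
have mp (f : R -> R) : measurable_fun setT f ->
    measurable_fun setT (fun x => tempered_power lambda (H - (alpha x)^-1) (f x)).
  move=> mf; apply: measurable_funM.
    apply: measurableT_comp => //; apply: measurable_funM => //.
    exact: measurable_maxr.
  apply: measurable_fun_ifT => //; first exact: measurable_fun_ltr.
  exact: measurable_fun_powR2.
apply: measurable_funB; apply: mp; apply: continuous_measurable_fun => x.
  by apply: cvgB; [exact: cvg_cst|exact: cvg_id].
by apply: cvgN; exact: cvg_id.
Qed.

(** The line is cut at [s - h] and [s + h]. The middle piece gives [2 * M / h] times its length
    [2 * h], hence the 4; the left piece is the tail integral with [q = 1 - H], hence [(1 - H)^-1].
    One [M] serves all exponents in [[a, b]] because [alpha x] varies under the integral. *)
Lemma integral_tempered_kernel_incr (R : realType) (H : R) (alpha : R -> R)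
    (lambda c s h M a b : R) :
  1 < a -> b <= 2 -> (forall x, a <= alpha x <= b) -> continuous alpha ->
  0 < H -> H < 1 -> 1 < H * a -> 0 <= lambda -> 0 <= c -> 0 < h ->
  (forall p, a <= p -> p <= b -> c `^ p * h `^ (H * p) <= M) ->
  (\int[lebesgue_measure]_x
    (`|c * (tempered_kernel H alpha lambda (s + h) x -
            tempered_kernel H alpha lambda s x)| `^ alpha x)%:E
   <= ((4 + (1 - H)^-1) * M)%:E)%E.
Proof.
move=> a1 b2 hal ca H0 H1 Ha l0 c0 h0 hM.
have al0 x : alpha x != 0 by have /andP[ax _] := hal x; apply: lt0r_neq0; lra.
set D := fun x => tempered_kernel H alpha lambda (s + h) x -
            tempered_kernel H alpha lambda s x.
set f := fun x => (`|c * D x| `^ alpha x)%:E.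
have mf : measurable_fun setT f.
  apply/measurable_EFinP; apply: measurable_fun_powR2; last exact: continuous_measurable_fun.
  apply: measurableT_comp => //; apply: measurable_funM => //.
  by apply: measurable_funB; exact: measurable_tempered_kernel.
have f0 x : (0 <= f x)%E by rewrite lee_fin powR_ge0.
have DE x : D x = tempered_power lambda (H - (alpha x)^-1) (s + h - x)
   - tempered_power lambda (H - (alpha x)^-1) (s - x).
  by rewrite /D !tempered_kernelE; ring.
have hal2 x : [/\ 1 <= alpha x, 1 <= H * alpha x <= 2 &
    c `^ alpha x * h `^ (H * alpha x) <= M].
  have /andP[h1 h2] := hal x; split; [lra|apply/andP; split; nra|exact: hM].
(* The condition [1 < H * a] keeps the kernel exponent nonnegative, so the kernel stays bounded near
   its end point. *)
have g01 x : 0 <= H - (alpha x)^-1 <= 1.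
  have [h1 /andP[h2 h3] _] := hal2 x.
  have h4 : (alpha x)^-1 <= H by rewrite -[_^-1]mul1r ler_pdivrMr //; lra.
  have h5 : 0 <= (alpha x)^-1 by rewrite invr_ge0; lra.
  by apply/andP; split; lra.
have M0 : 0 <= M.
  by have [_ _] := hal2 0; apply: le_trans; rewrite mulr_ge0 ?powR_ge0.
have far x : x <= s - h -> `|c * D x| `^ alpha x <= M * h `^ (1 - H) * (s - x) `^ (- (1 - H) - 1).
  move=> xs; have [h1 h2 h3] := hal2 x.
  rewrite normrM (ger0_norm c0) -mulrA (_ : - (1 - H) - 1 = H - 2); last by ring.
  apply: (powR_far_bound (H := H)) => //; [lra|lra|].
  rewrite DE (_ : s + h - x = (s - x) + h); last by ring.
  by apply: tempered_power_incr => //; lra.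
(* Both profiles lie between 0 and [(2 * h) ^ (H - 1 / alpha x)], hence so does the absolute value
   of their difference. *)
have near_ x : s - h < x -> `|c * D x| `^ alpha x <= 2 * M / h.
  move=> xs; have [h1 h2 h3] := hal2 x.
  rewrite normrM (ger0_norm c0); apply: (powR_near_bound (H := H)) => //; first lra.
  have /andP[g0 _] := g01 x.
  have p1 : tempered_power lambda (H - (alpha x)^-1) (s + h - x) <= (2 * h) `^ (H - (alpha x)^-1).
    by apply: tempered_power_le => //; lra.
  have p2 : tempered_power lambda (H - (alpha x)^-1) (s - x) <= (2 * h) `^ (H - (alpha x)^-1).
    by apply: tempered_power_le => //; lra.
  have q1 := tempered_power_ge0 lambda (H - (alpha x)^-1) (s + h - x).
  have q2 := tempered_power_ge0 lambda (H - (alpha x)^-1) (s - x).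
  by rewrite DE ler_norml; apply/andP; split; lra.
have zero x : s + h <= x -> `|c * D x| `^ alpha x = 0.
  by move=> xs; rewrite DE !tempered_power_npos ?subrr ?mulr0 ?normr0 ?powR0//; lra.
have -> : [set: R] = `]-oo, s - h] `|` (`]s - h, s + h[ `|` `[s + h, +oo[).
  apply/seteqP; split=> x //= _; rewrite !in_itv/= andbT.
  have [xs|xs] := leP x (s - h); first by left.
  by right; have [xs2|xs2] := ltP x (s + h); [left|right].
have mpow : measurable_fun setT (fun x : R => ((s - x) `^ (- (1 - H) - 1))%:E).
  apply/measurable_EFinP; apply: (measurableT_comp (measurable_powR _)).
  by apply: continuous_measurable_fun => x; apply: cvgB; [exact: cvg_cst|exact: cvg_id].
have disj1 : [disjoint `]-oo, s - h]%classic & (`]s - h, s + h[ `|` `[s + h, +oo[)%classic].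
  apply/disj_setPS => x /= [] /=; rewrite !in_itv/= => x1 [/andP[x2 x3]|]; first lra.
  by rewrite andbT => x2; lra.
have disj2 : [disjoint `]s - h, s + h[%classic & `[s + h, +oo[%classic].
  by apply/disj_setPS => x /= [] /=; rewrite !in_itv/= andbT => /andP[x1 x3] x2; lra.
rewrite ge0_integral_setU//; last 2 first.
- exact: measurableU.
- exact: measurable_funTS.
rewrite ge0_integral_setU//; last exact: measurable_funTS.
rewrite [X in (_ + (_ + X) <= _)%E]integral0_eq; last first.
  by move=> x /=; rewrite in_itv/= andbT => xs; rewrite zero.
rewrite adde0 addeC mulrDl EFinD leeD//.
  apply: (@le_trans _ _ (\int[lebesgue_measure]_(x in `](s - h)%R, (s + h)%R[) (cst (2 * M / h)%:E x))%E).
    apply: ge0_le_integral => //; first exact: measurable_funTS.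
    by move=> x /=; rewrite in_itv/= => /andP[xs _]; rewrite lee_fin near_.
  rewrite integral_cst//= lebesgue_measure_itv/= ifT; last by rewrite lte_fin; lra.
  rewrite -EFinB -EFinM lee_fin (_ : 2 * M / h * _ = 4 * M)//.
  by field; rewrite gt_eqF.
apply: (@le_trans _ _ (\int[lebesgue_measure]_(x in `]-oo, (s - h)%R])
   ((M * h `^ (1 - H))%:E * ((s - x) `^ (- (1 - H) - 1))%:E))%E).
  apply: ge0_le_integral => //; first exact: measurable_funTS.
  by apply: measurable_funTS; exact: measurable_funeM.
rewrite ge0_integralZl//; last 3 first.
- exact: measurable_funTS.
- by move=> x _; rewrite lee_fin powR_ge0.
- by rewrite lee_fin mulr_ge0 ?powR_ge0.
rewrite integral_powR_tail//; last lra.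
rewrite -EFinM lee_fin powRN (_ : _ * _ * _ = (1 - H)^-1 * M)//.
by field; rewrite powR_eq0 negb_and (gt_eqF h0) gt_eqF//; lra.
Qed.

(** * Tails of the increments *)

(** The characteristic function with coefficients [c] and [- c] has real part
    [E cos (c (I f - I g)) = e^(- J)], where [J] is the integral in the hypothesis, and
    [1 - e^(- J) <= J]. *)
Lemma multistable_increment_cos (d : measure_display) (T : measurableType d)
    (R : realType) (P : probability T R) (alpha : R -> R)
    (I : (R -> R) -> {RV P >-> R}) (f g : R -> R) (c K : R) :
  is_multistable_integral alpha I ->
  multistable_integrable alpha f -> multistable_integrable alpha g ->
  (\int[lebesgue_measure]_x (`|c * (f x - g x)| `^ alpha x)%:E <= K%:E)%E ->
  (\int[P]_w (1 - cos (c * (I f w - I g w)))%:E <= K%:E)%E.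
Proof.
move=> hI hf hg hK.
have := hI 2%N (fun k => if k == ord0 then c else - c)
  (fun k => if k == ord0 then f else g).
have hfg k : multistable_integrable alpha (if k == ord0 :> 'I_2 then f else g).
  by case: ifP.
move=> /(_ hfg) []/= + _.
under eq_fun do rewrite !big_ord_recl big_ord0/= addr0 mulNr -mulrBr.
under eq_Rintegral do rewrite !big_ord_recl big_ord0/= addr0 mulNr -mulrBr.
rewrite unlock /Rintegral => hcos.
set X := fun w => cos (c * (I f w - I g w)).
have mX : measurable_fun setT X.
  apply: measurableT_comp; first exact: (continuous_measurable_fun (@continuous_cos R)).
  by apply: measurable_funM => //; exact: measurable_funB.
have iX : P.-integrable setT (EFin \o X).
  apply: measurable_bounded_integrable => //; first by rewrite (le_lt_trans (probability_le1 _ _)) ?ltry.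
  by exists 1; split; [exact: num_real|move=> r r1 w _ /=; rewrite (le_trans (cos_max _))// ltW].
have i1 : P.-integrable setT (EFin \o cst (1 : R)).
  exact: finite_measure_integrable_cst.
under eq_integral do rewrite EFinB.
rewrite (@integralB_EFin _ _ _ _ _ (cst 1) X)//.
have -> : (\int[P]_x (cst 1 x)%:E = 1)%E.
  by have := integral_cst P (@measurableT _ T) 1%E; rewrite /= probability_setT mule1.
rewrite -(fineK (integrable_fin_num _ iX))//= hcos -EFinB lee_fin.
set J := fine _.
(* The bound [hK] makes the extended integral finite, so [fine] keeps its value. *)
have JK : J <= K.
  rewrite -lee_fin fineK// ge0_fin_numE; last first.
    by apply: integral_ge0 => x _; rewrite lee_fin powR_ge0.
  exact: le_lt_trans hK (ltry _).
by have := expR_ge1Dx (- J); lra.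
Qed.

Lemma dyadic_scale (R : realType) (z : R) : 1 < z -> exists k : nat, 2 ^+ k < z <= 2 ^+ k.+1.
Proof.
move=> z1.
have ex : exists n : nat, z <= 2 ^+ n.
  exists (Num.truncn z).+1; rewrite (@le_trans _ _ (Num.truncn z).+1%:R)//.
    by rewrite ltW// truncnS_gt.
  by rewrite -natrX ler_nat ltnW// ltn_expl.
(* The least exponent works; it is not 0 because [z > 1]. *)
case: (ex_minnP ex) => -[|k] hk hmin; first by move: hk; rewrite expr0 leNgt z1.
exists k; rewrite hk andbT ltNge; apply/negP => /hmin.
by rewrite ltnn.
Qed.

(** The scale [k] brings [|y| / u] into []1, 2]]. Cosine is even and decreases on [[0, pi]], which
    contains 1 and 2. *)
Lemma one_sub_cos_scale (R : realType) (u y : R) : 0 < u -> u < `|y| ->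
  exists k : nat, 1 - cos (1 : R) <= 1 - cos ((2 ^+ k)^-1 / u * y).
Proof.
move=> u0 uy; have z1 : 1 < `|y| / u by rewrite ltr_pdivlMr// mul1r.
have [k /andP[k1 k2]] := dyadic_scale z1; exists k.
have p0 : 0 < (2 : R) ^+ k by rewrite exprn_gt0.
rewrite lerD2l lerN2 -[X in X <= _]cos_norm !normrM !normfV.
rewrite (gtr0_norm u0) (gtr0_norm p0).
set z := _ * `|y|.
have zE : z = `|y| / u / 2 ^+ k by rewrite /z; field; rewrite !gt_eqF.
have z1' : 1 < z by rewrite zE ltr_pdivlMr// mul1r.
have z2 : z <= 2 by rewrite zE ler_pdivrMr// -exprS.
have := @pi_ge2 R => hpi.
rewrite le_eqVlt; apply/orP; right.
by rewrite ltr_cos// in_itv/=; apply/andP; split; lra.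
Qed.

Lemma measurable_norm_gt (d : measure_display) (T : measurableType d) (R : realType)
    (Y : T -> R) (u : R) : measurable_fun setT Y -> measurable [set w | u < `|Y w|].
Proof.
move=> mY; rewrite (_ : [set w | _] = setT `&` (fun w => `|Y w|) @^-1` `]u, +oo[).
  have mN : measurable_fun setT (fun w => `|Y w|) by exact: measurableT_comp.
  exact: mN.
by apply/seteqP; split=> w /=; rewrite in_itv/= andbT => // -[].
Qed.

(* [1 - cos z] is bounded below for [1 <= `|z| <= 2], so the scales [2 ^- k]
   together detect every value of [Y / u] above 1. *)
Lemma probability_norm_gt_le (d : measure_display) (T : measurableType d)
    (R : realType) (P : probability T R) (Y : T -> R) (u K : R) :
  measurable_fun setT Y -> 0 < u -> 0 <= K ->
  (forall k : nat, (\int[P]_w (1 - cos ((2 ^+ k)^-1 / u * Y w))%:E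
     <= (K / (2 ^ k.+1)%:R)%:E)%E) ->
  (P [set w | (u < `|Y w|)%R] <= (K / (1 - cos 1))%:E)%E.
Proof.
move=> mY u0 K0 hK.
have e0 : 0 < 1 - cos (1 : R).
  rewrite subr_gt0 -[X in _ < X](@cos0 R) ltr_cos// in_itv/= ?lexx ?ler01 ?pi_ge0//.
  by have := @pi_ge2 R; lra.
pose g (k : nat) w := 1 - cos ((2 ^+ k)^-1 / u * Y w).
have mg k : measurable_fun setT (g k).
  apply: measurable_funB => //.
  apply: measurableT_comp; first exact: (continuous_measurable_fun (@continuous_cos R)).
  exact: measurable_funM.
pose A k := [set w | 1 - cos (1 : R) <= g k w].
have mA k : measurable (A k).
  rewrite (_ : A k = setT `&` g k @^-1` `[1 - cos (1 : R), +oo[); first exact: mg.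
  by apply/seteqP; split=> w; rewrite /A/= in_itv/= andbT => // -[].
(* Markov's inequality: [g k] is at least [1 - cos 1] on [A k]. *)
have PA k : (P (A k) <= (K / (1 - cos 1) / (2 ^ k.+1)%:R)%:E)%E.
  rewrite mulrAC EFinM lee_pdivlMr// muleC.
  rewrite -(integral_cst _ (mA k)).
  apply: le_trans (hK k).
  apply: (@le_trans _ _ (\int[P]_(w in A k) (g k w)%:E)%E).
    apply: ge0_le_integral => //.
    - by move=> w _; rewrite lee_fin ltW.
    - by apply/measurable_EFinP; exact: measurable_funTS.
  apply: ge0_subset_integral => //; first exact/measurable_EFinP.
  by move=> w _; rewrite lee_fin subr_ge0 cos_le1.
have mS : measurable [set w | u < `|Y w|] by exact: measurable_norm_gt.
apply: (@le_trans _ _ (\sum_(k <oo) P (A k))%E).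
  apply: measure_sigma_subadditive => //.
  by move=> w /= /(one_sub_cos_scale u0)[k hk]; exists k.
(* The weights [1 / 2 ^ (k + 1)] add up to 1. *)
apply: le_trans (epsilon_trick0 xpredT (divr_ge0 K0 (ltW e0))).
exact: lee_nneseries.
Qed.

Lemma tempered_kernel0 (R : realType) (H : R) (alpha : R -> R) (lambda x : R) :
  tempered_kernel H alpha lambda 0 x = 0.
Proof. by rewrite tempered_kernelE sub0r subrr. Qed.

(** The kernel vanishes at time 0, so up to sign the kernel at [t] is its increment between 0 and
    [t], and the increment bound with [c = 1] applies. *)
Lemma multistable_integrable_tempered_kernel (R : realType) (H : R)
    (alpha : R -> R) (lambda a b t : R) :
  1 < a -> b <= 2 -> (forall x, a <= alpha x <= b) -> continuous alpha ->
  0 < H -> H < 1 -> 1 < H * a -> 0 <= lambda ->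
  multistable_integrable alpha (tempered_kernel H alpha lambda t).
Proof.
move=> a1 b2 hal ca H0 H1 Ha l0.
have al0 x : alpha x != 0 by have /andP[ax _] := hal x; apply: lt0r_neq0; lra.
split; first exact: measurable_tempered_kernel.
(* Enlarging the base to [1 + h >= 1] allows the exponent [H * p] to be raised to 2, whatever the
   size of [h]. *)
have hM (h : R) : 0 < h -> forall p, a <= p -> p <= b ->
    1 `^ p * h `^ (H * p) <= (1 + h) `^ 2.
  move=> h0 p ap pb; rewrite powR1 mul1r.
  apply: (@le_trans _ _ ((1 + h) `^ (H * p))).
    rewrite ge0_ler_powR ?nnegrE//; [by rewrite mulr_ge0//; lra|lra|lra|lra].
  by rewrite ler_powR//; [lra|nra].
have [t0|t0|->] := ltgtP t 0.
- have nt : 0 < - t by lra.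
  have hint := integral_tempered_kernel_incr t a1 b2 hal ca H0 H1 Ha l0 ler01 nt (hM _ nt).
  apply: le_lt_trans (ltry _); apply: le_trans hint.
  rewrite le_eqVlt; apply/orP; left; apply/eqP; apply: eq_integral => x _.
  by rewrite subrr tempered_kernel0 sub0r mul1r normrN.
- have hint := integral_tempered_kernel_incr 0 a1 b2 hal ca H0 H1 Ha l0 ler01 t0 (hM _ t0).
  apply: le_lt_trans (ltry _); apply: le_trans hint.
  rewrite le_eqVlt; apply/orP; left; apply/eqP; apply: eq_integral => x _.
  by rewrite add0r tempered_kernel0 subr0 mul1r.
- rewrite integral0_eq ?ltry// => x _.
  by rewrite tempered_kernel0 normr0 powR0.
Qed.

(** For [c = 2 ^- k / h ^ beta], the quantity [c ^ p * h ^ (H * p)] is at most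
    [2 ^- k * h ^ ((H - beta) * a)], because [p >= a > 1] and [h <= 1]. So the cosine bounds decay
    geometrically in [k], as the tail estimate requires. *)
Lemma LTFmSM_increment_tail (d : measure_display) (T : measurableType d)
    (R : realType) (P : probability T R) (I : (R -> R) -> {RV P >-> R})
    (H : R) (alpha : R -> R) (lambda a b beta : R) :
  1 < a -> b <= 2 -> (forall x, a <= alpha x <= b) -> continuous alpha ->
  0 < H -> H < 1 -> 1 < H * a -> 0 <= lambda ->
  is_multistable_integral alpha I -> beta < H ->
  exists2 C : R, 0 <= C & forall s h : R, 0 < h -> h <= 1 ->
    (P [set w | (h `^ beta <
      `|LTFmSM I H alpha lambda (s + h) w - LTFmSM I H alpha lambda s w|)%R]
     <= (C * h `^ ((H - beta) * a))%:E)%E.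
Proof.
move=> a1 b2 hal ca H0 H1 Ha l0 hI bH.
set C0 := 4 + (1 - H)^-1.
have C00 : 0 <= C0 by rewrite addr_ge0// invr_ge0; lra.
have e0 : 0 <= 1 - cos (1 : R) by rewrite subr_ge0 cos_le1.
(* The factor 2 makes up the difference between the decay [2 ^- k] and the weight [1 / 2 ^ (k + 1)];
   [1 - cos 1] comes from the tail estimate. *)
exists (2 * C0 / (1 - cos 1)); first by rewrite !mulr_ge0// invr_ge0.
move=> s h h0 h1.
have u0 : 0 < h `^ beta by exact: powR_gt0.
rewrite (_ : 2 * C0 / (1 - cos 1) * h `^ ((H - beta) * a) =
  (2 * C0 * h `^ ((H - beta) * a)) / (1 - cos 1)); last by ring.
apply: probability_norm_gt_le => //.
- exact: measurable_funB.
- by rewrite !mulr_ge0 ?powR_ge0.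
move=> k; apply: multistable_increment_cos hI _ _ _;
  [exact: multistable_integrable_tempered_kernel a1 b2 hal ca H0 H1 Ha l0|
   exact: multistable_integrable_tempered_kernel a1 b2 hal ca H0 H1 Ha l0|].
have p0 : 0 < (2 : R) ^+ k by rewrite exprn_gt0.
have c0 : 0 <= (2 ^+ k)^-1 / h `^ beta by rewrite divr_ge0 ?invr_ge0// ltW.
rewrite (_ : 2 * C0 * _ / _ = C0 * ((2 ^+ k)^-1 * h `^ ((H - beta) * a))); last first.
  rewrite natrX exprS; field.
  by rewrite (gt_eqF p0).
apply: (integral_tempered_kernel_incr s a1 b2 hal ca H0 H1 Ha l0 c0 h0) => p ap pb.
have p1 : 1 <= p by lra.
rewrite powRM ?invr_ge0 ?(ltW p0) ?(ltW u0)//.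
rewrite -mulrA ler_pM ?mulr_ge0 ?powR_ge0//.
  rewrite ge1r_powR// invr_gt0 p0/= invf_le1//.
  by rewrite exprn_ege1// ler1n.
rewrite -[(h `^ beta)^-1]powRN -powRrM -powRD; last by rewrite (gt_eqF h0) implybT.
rewrite ger_powR ?h0// (_ : - beta * p + H * p = (H - beta) * p); last by ring.
by rewrite ler_wpM2l//; lra.
Qed.

(** * Paths with small dyadic increments *)

(** With [e] the remainder of the geometric series, [u - e] is nondecreasing and [u + e]
    nonincreasing from [n0] on. These adjacent sequences have a common limit and enclose it at every
    level. *)
Lemma geometric_increments_cvg (R : realType) (q : R) (u : R^nat) (n0 : nat) :
  0 <= q -> q < 1 -> (forall n, (n0 <= n)%N -> `|u n.+1 - u n| <= q ^+ n) ->
  cvgn u /\ forall n, (n0 <= n)%N -> `|limn u - u n| <= q ^+ n / (1 - q).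
Proof.
move=> q0 q1 hu.
pose e n := q ^+ (n + n0) / (1 - q).
pose lo n := u (n + n0)%N - e n; pose hi n := u (n + n0)%N + e n.
have eS n : e n - e n.+1 = q ^+ (n + n0).
  by rewrite /e addSn exprS; field; rewrite subr_eq0 gt_eqF.
have hu' n : - q ^+ (n + n0) <= u (n.+1 + n0)%N - u (n + n0)%N <= q ^+ (n + n0).
  by rewrite -ler_norml addSn; apply: hu; rewrite leq_addl.
have lon : nondecreasing_seq lo.
  apply/nondecreasing_seqP => n; rewrite /lo.
  by have /andP[h1 h2] := hu' n; have := eS n; lra.
have hin : nonincreasing_seq hi.
  apply/nonincreasing_seqP => n; rewrite /hi.
  by have /andP[h1 h2] := hu' n; have := eS n; lra.
have e0 : e @ \oo --> (0 : R).
  rewrite -[X in _ --> X](mul0r (1 - q)^-1); apply: cvgMl.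
  rewrite (cvg_shiftn n0 (fun n => q ^+ n)); apply: cvg_expr.
  by rewrite ger0_norm.
have hl0 : hi - lo @ \oo --> (0 : R).
  have -> : hi - lo = e + e.
    by apply/funext => n; rewrite /hi /lo !fctE; ring.
  by rewrite -[X in _ --> X]addr0; exact: cvgD.
have [lE clo chi] := adjacent_seq lon hin hl0.
have ul : u @ \oo --> limn lo.
  have : [sequence u (n + n0)%N]_n @ \oo --> limn lo.
    rewrite (_ : [sequence _]_n = lo + e); last first.
      by apply/funext => n; rewrite /lo !fctE/= subrK.
    by rewrite -[limn lo]addr0; exact: cvgD.
  by rewrite cvg_shiftn.
split; first by apply/cvg_ex; exists (limn lo).
move=> n n0n; rewrite (cvg_lim _ ul)//.
have h1 := nondecreasing_cvgn_le lon clo (n - n0)%N.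
have h2 := nonincreasing_cvgn_ge hin chi (n - n0)%N.
move: h1 h2; rewrite lE /lo /hi /e subnK// => h1 h2.
by rewrite ler_norml; apply/andP; split; lra.
Qed.

Definition dyadic_floor (R : realType) (n : nat) (t : R) : R :=
  (Num.floor (2 ^+ n * t))%:~R / 2 ^+ n.

Lemma exp2_gt0 (R : realType) (n : nat) : 0 < (2 : R) ^+ n.
Proof. by rewrite exprn_gt0. Qed.

Lemma dyadic_floor_itv (R : realType) (n : nat) (t : R) :
  dyadic_floor n t <= t < dyadic_floor n t + (2 ^+ n)^-1.
Proof.
have p0 := exp2_gt0 R n.
have /andP[h1 h2] := floor_itv (2 ^+ n * t).
rewrite /dyadic_floor; apply/andP; split; first by rewrite ler_pdivrMr// [t * _]mulrC.
by rewrite -[X in _ + X]div1r -mulrDl ltr_pdivlMr// [t * _]mulrC; move: h2; rewrite intrD.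
Qed.

(** The condition on [j] keeps the left grid point [j / 2 ^ n] in [[- N, N]], which leaves finitely
    many increments at each level. *)
Definition dyadic_increments_le (R : realType) (q : R) (N n : nat) (X : R -> R) :=
  forall j : int, `|j|%:~R <= N%:R * 2 ^+ n :> R ->
    `|X ((j + 1)%:~R / 2 ^+ n) - X (j%:~R / 2 ^+ n)| <= q ^+ n.

(** The spare 1 in [|t| + 1 <= N] becomes [2 ^ n] after scaling and absorbs the rounding, which
    costs at most 1. *)
Lemma floor_window (R : realType) (N n : nat) (t : R) : `|t| + 1 <= N%:R ->
  `|Num.floor (2 ^+ n * t)|%:~R <= N%:R * 2 ^+ n :> R.
Proof.
move=> tN; have p0 := exp2_gt0 R n.
have p1 : 1 <= (2 : R) ^+ n by rewrite exprn_ege1// ler1n.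
have /andP[h1] := floor_itv (2 ^+ n * t); rewrite intrD => h2.
have : - `|t| <= t <= `|t| by rewrite -ler_norml.
move=> /andP[t1 t2]; rewrite intr_norm ler_norml; apply/andP; split; nra.
Qed.

(** If [m] is the floor at level [n], the floor at level [n + 1] is [2 m] or [2 m + 1], so the two
    approximations coincide or are neighbours on the finer grid. *)
Lemma dyadic_floorS (R : realType) (q : R) (N n : nat) (X : R -> R) (t : R) :
  0 <= q -> dyadic_increments_le q N n.+1 X -> `|t| + 1 <= N%:R ->
  `|X (dyadic_floor n.+1 t) - X (dyadic_floor n t)| <= q ^+ n.+1.
Proof.
move=> q0 hX tN; rewrite /dyadic_floor.
set m := Num.floor (2 ^+ n * t); set m' := Num.floor _.
have p0 := exp2_gt0 R n.
have /andP[h1 h2] := floor_itv (2 ^+ n * t); rewrite -/m in h1 h2.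
have /andP[h3 h4] := floor_itv (2 ^+ n.+1 * t); rewrite -/m' in h3 h4.
have mE : m%:~R / 2 ^+ n = (2 * m)%:~R / 2 ^+ n.+1 :> R.
  by rewrite intrM exprS; field; rewrite gt_eqF.
have lo : (2 * m < m' + 1).
  by rewrite -(ltr_int R) intrM (le_lt_trans _ h4)// exprS -mulrA ler_wpM2l.
have hi : (m' < 2 * m + 2).
  rewrite -(ltr_int R) intrD intrM (le_lt_trans h3)// exprS -mulrA.
  by move: h2; rewrite intrD; lra.
have [m'E|m'E] : m' = 2 * m \/ m' = 2 * m + 1 by lia.
  by rewrite mE m'E subrr normr0 exprn_ge0.
rewrite mE m'E; apply: hX.
have := floor_window n tN; rewrite -/m normrM intrM exprS mulrCA.
by rewrite (_ : `|2 : int|%:~R = 2 :> R)// ler_pM2l.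
Qed.

(** As [limn] is total, the value is meaningful only where the sequence converges; [dyadic_lim_dist]
    gives this for paths with small dyadic increments. *)
Definition dyadic_lim (R : realType) (X : R -> R) (t : R) : R :=
  limn (fun n => X (dyadic_floor n t)).

Lemma dyadic_lim_dist (R : realType) (q : R) (N n0 : nat) (X : R -> R) (t : R) :
  0 <= q -> q < 1 -> (forall n, (n0 <= n)%N -> dyadic_increments_le q N n X) ->
  `|t| + 1 <= N%:R ->
  cvgn (fun n => X (dyadic_floor n t)) /\
  forall n, (n0 <= n)%N ->
    `|dyadic_lim X t - X (dyadic_floor n t)| <= q ^+ n / (1 - q).
Proof.
move=> q0 q1 hX tN.
apply: (geometric_increments_cvg (u := fun n => X (dyadic_floor n t))) => // n n0n.
apply: le_trans (dyadic_floorS q0 (hX _ (leqW n0n)) tN) _.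
by rewrite exprS ler_piMl ?exprn_ge0// ltW.
Qed.

(** Times less than one mesh apart round down to the same or to neighbouring grid points. *)
Lemma dyadic_floor_close (R : realType) (q : R) (N n : nat) (X : R -> R) (s t : R) :
  0 <= q -> dyadic_increments_le q N n X -> `|s| + 1 <= N%:R ->
  s <= t -> t - s < (2 ^+ n)^-1 ->
  `|X (dyadic_floor n s) - X (dyadic_floor n t)| <= q ^+ n.
Proof.
move=> q0 hX sN st ts; have p0 := exp2_gt0 R n.
rewrite /dyadic_floor; set m := Num.floor (2 ^+ n * s); set m' := Num.floor _.
have mm' : (m <= m') by apply: le_floor; rewrite ler_pM2l.
have /andP[h1 h2] := floor_itv (2 ^+ n * s); rewrite -/m in h1 h2.
have /andP[h3 h4] := floor_itv (2 ^+ n * t); rewrite -/m' in h3 h4.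
have ts' : 2 ^+ n * t < 2 ^+ n * s + 1.
  by rewrite -ltrBlDl -mulrBr mulrC -ltr_pdivlMr// div1r.
have hi : (m' < m + 2).
  by rewrite -(ltr_int R) intrD; move: h2; rewrite intrD; lra.
have [->|->] : m' = m \/ m' = m + 1 by lia.
  by rewrite subrr normr0 exprn_ge0.
by rewrite distrC; apply: hX; exact: floor_window.
Qed.

(** Triangle inequality through the two grid points: each limit costs [q ^ n / (1 - q)] and the step
    between the grid points [q ^ n]. *)
Lemma dyadic_lim_close (R : realType) (q : R) (N n0 n : nat) (X : R -> R) (s t : R) :
  0 <= q -> q < 1 -> (forall n, (n0 <= n)%N -> dyadic_increments_le q N n X) ->
  `|s| + 1 <= N%:R -> `|t| + 1 <= N%:R -> (n0 <= n)%N ->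
  s <= t -> t - s < (2 ^+ n)^-1 ->
  `|dyadic_lim X s - dyadic_lim X t| <= (1 + 2 / (1 - q)) * q ^+ n.
Proof.
move=> q0 q1 hX sN tN n0n st ts.
have [_ /(_ _ n0n) h1] := dyadic_lim_dist q0 q1 hX sN.
have [_ /(_ _ n0n) h2] := dyadic_lim_dist q0 q1 hX tN.
have h3 := dyadic_floor_close q0 (hX _ n0n) sN st ts.
rewrite (_ : (1 + 2 / (1 - q)) * q ^+ n =
   q ^+ n / (1 - q) + (q ^+ n + q ^+ n / (1 - q))); last by ring.
rewrite (_ : dyadic_lim X s - dyadic_lim X t =
  (dyadic_lim X s - X (dyadic_floor n s)) +
  ((X (dyadic_floor n s) - X (dyadic_floor n t)) +
   (X (dyadic_floor n t) - dyadic_lim X t))); last by ring.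
apply: le_trans (ler_normD _ _) _; rewrite lerD//.
by apply: le_trans (ler_normD _ _) _; rewrite lerD// distrC.
Qed.

(** For the ratio [q = 2 ^ (- beta)], the threshold [q ^ n] is the mesh [2 ^- n] to the power
    [beta]; this is the source of the Hölder exponent. *)
Lemma powR_half (R : realType) (beta : R) (n : nat) :
  (2 `^ (- beta)) ^+ n = ((2 ^+ n)^-1) `^ beta :> R.
Proof.
by rewrite -powR_mulrn ?powR_ge0// -powRrM -[(2 ^+ n)^-1]powR_invn// -powRrM; congr (_ `^ _); ring.
Qed.

Lemma powR2_lt1 (R : realType) (x : R) : x < 0 -> 2 `^ x < 1.
Proof.
move=> x0; have l2 : 0 < ln (2 : R) by rewrite ln_gt0// ltr1n.
by rewrite /powR pnatr_eq0/= -[ltRHS]expR0 ltr_expR pmulr_llt0.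
Qed.

(** The level [n] is chosen with [2 ^- (n + 1) <= |s - t| < 2 ^- n]. Replacing the mesh by at most
    twice the distance costs the factor [2 ^ beta]. *)
Lemma dyadic_lim_locally_holder (R : realType) (beta : R) (N n0 : nat) (X : R -> R) :
  0 < beta ->
  (forall n, (n0 <= n)%N -> dyadic_increments_le (2 `^ (- beta)) N n X) ->
  exists2 C : R, 0 <= C & forall s t, `|s| + 1 <= N%:R -> `|t| + 1 <= N%:R ->
    `|s - t| < (2 ^+ n0)^-1 ->
    `|dyadic_lim X s - dyadic_lim X t| <= C * `|s - t| `^ beta.
Proof.
move=> b0 hX; set q := 2 `^ (- beta) in hX.
have q0 : 0 <= q by exact: powR_ge0.
have q1 : q < 1.
  by rewrite powR2_lt1// oppr_lt0.
have C0 : 0 <= 1 + 2 / (1 - q).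
  by rewrite addr_ge0// divr_ge0// subr_ge0 ltW.
exists ((1 + 2 / (1 - q)) * 2 `^ beta); first by rewrite mulr_ge0 ?powR_ge0.
have key s t : `|s| + 1 <= N%:R -> `|t| + 1 <= N%:R -> s < t ->
    t - s < (2 ^+ n0)^-1 ->
    `|dyadic_lim X s - dyadic_lim X t| <= (1 + 2 / (1 - q)) * 2 `^ beta * (t - s) `^ beta.
  move=> sN tN st ts.
  have d0 : 0 < t - s by rewrite subr_gt0.
  have ex : exists n, (2 ^+ n.+1)^-1 <= t - s.
    exists (Num.truncn (t - s)^-1).
    rewrite -[leRHS]invrK lef_pV2 ?posrE ?exp2_gt0 ?invr_gt0//.
    apply: (@le_trans _ _ (Num.truncn (t - s)^-1).+1%:R); first by rewrite ltW// truncnS_gt.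
    by rewrite -natrX ler_nat ltnW// ltn_expl.
  have n0m n : (2 ^+ n.+1)^-1 <= t - s -> (n0 <= n)%N.
    move=> h; rewrite leqNgt; apply/negP => nn0.
    have := le_lt_trans h ts; rewrite ltf_pV2 ?posrE ?exp2_gt0//.
    by rewrite ltr_eXn2l ?ltr1n// ltnNge nn0.
  case: (ex_minnP ex) => n hn hmin.
  have nn0 := n0m _ hn.
  (* For [n = n0] this is the hypothesis on [t - s]; otherwise it is the minimality of [n]. *)
  have tsn : t - s < (2 ^+ n)^-1.
    move: nn0; rewrite leq_eqVlt => /predU1P[<-//|].
    case: n hn hmin => // n hn hmin _; rewrite ltNge; apply/negP => /hmin.
    by rewrite ltnn.
  apply: le_trans (dyadic_lim_close q0 q1 hX sN tN nn0 (ltW st) tsn) _.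
  rewrite -mulrA ler_wpM2l// powR_half -powRM ?(ltW d0)//.
  rewrite ge0_ler_powR ?nnegrE ?invr_ge0 ?mulr_ge0 ?(ltW b0) ?(ltW d0) ?(ltW (exp2_gt0 R n))//.
  by move: hn; rewrite exprS invfM ler_pdivrMl.
move=> s t sN tN st; have [lt_st|lt_ts|->] := ltgtP s t.
- rewrite [`|s - t|]distrC in st *; rewrite gtr0_norm ?subr_gt0// in st *.
  exact: key.
- rewrite gtr0_norm ?subr_gt0// in st *.
  by rewrite distrC; apply: key.
- by rewrite !subrr normr0 !mulr_ge0 ?powR_ge0.
Qed.

Definition dyadic_regular (R : realType) (q : R) (X : R -> R) :=
  forall N : nat, exists n0 : nat, forall n, (n0 <= n)%N -> dyadic_increments_le q N n X.

Lemma dyadic_lim_continuous (R : realType) (beta : R) (X : R -> R) :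
  0 < beta -> dyadic_regular (2 `^ (- beta)) X -> continuous (dyadic_lim X).
Proof.
move=> b0 hX t.
(* One unit more than [t] itself requires, so that every [s] within distance 1 of [t] fits the same
   window. *)
pose N := (Num.truncn (`|t| + 2)).+1.
have tN : `|t| + 2 <= N%:R by rewrite ltW// truncnS_gt.
have [n0 hn0] := hX N.
have [C C0 hC] := dyadic_lim_locally_holder b0 hn0.
apply/cvgrPdist_lt => e e0.
have C1 : 0 < C + 1 by lra.
have r0 : 0 < e / (C + 1) by rewrite divr_gt0.
near=> s.
have h1 : `|t - s| < 1 by near: s; exact: cvgr_dist_lt.
have h2 : `|t - s| < (2 ^+ n0)^-1.
  by near: s; apply: cvgr_dist_lt => //; rewrite invr_gt0 exp2_gt0.
have h3 : `|t - s| < (e / (C + 1)) `^ beta^-1.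
  by near: s; apply: cvgr_dist_lt => //; exact: powR_gt0.
have h4 : `|t - s| `^ beta <= e / (C + 1).
  have -> : e / (C + 1) = ((e / (C + 1)) `^ beta^-1) `^ beta.
    by rewrite -powRrM mulVf ?lt0r_neq0// powRr1// ltW.
  by rewrite ge0_ler_powR ?nnegrE ?powR_ge0 ?(ltW b0) ?(ltW h3).
have sN : `|s| + 1 <= N%:R.
  have : `|s| <= `|t| + `|t - s|.
    by rewrite -{1}[s](subKr t) (le_trans (ler_normB _ _)).
  lra.
apply: le_lt_trans (hC t s _ sN h2) _; first lra.
apply: (@le_lt_trans _ _ (C * (e / (C + 1)))); first by rewrite ler_wpM2l.
by rewrite mulrCA -[ltRHS]mulr1 ltr_pM2l// ltr_pdivrMr//; lra.
Unshelve. all: by end_near. Qed.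

(** Short distances are covered by the local bound. At distances of at least [dl], the path is
    bounded by [B'] on the compact segment, and [2 * B'] is at most [2 * B' / dl ^ beta] times the
    power of the distance. *)
Lemma dyadic_lim_holder (R : realType) (beta u v : R) (X : R -> R) :
  0 < beta -> dyadic_regular (2 `^ (- beta)) X -> holder_on beta `[u, v] (dyadic_lim X).
Proof.
move=> b0 hX.
have cY := dyadic_lim_continuous b0 hX.
pose N := (Num.truncn (`|u| + `|v| + 1)).+1.
have uvN : `|u| + `|v| + 1 <= N%:R by rewrite ltW// truncnS_gt.
have sN s : `[u, v]%classic s -> `|s| + 1 <= N%:R.
  rewrite /= in_itv/= => /andP[us sv]; apply: le_trans uvN; rewrite lerD2r.
  have := ler_norm (- u); have := ler_norm v; rewrite normrN.
  have := normr_ge0 u; have := normr_ge0 v; rewrite ler_norml => *.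
  by apply/andP; split; lra.
have [n0 hn0] := hX N.
have [C C0 hC] := dyadic_lim_locally_holder b0 hn0.
have /compact_bounded[B [_ hB]] : compact (dyadic_lim X @` `[u, v]).
  apply: continuous_compact; first exact: continuous_subspaceT.
  exact: segment_compact.
pose B' := `|B| + 1.
have hB' s : `[u, v]%classic s -> `|dyadic_lim X s| <= B'.
  move=> us; apply: (hB B'); last by exists s.
  by rewrite /B' ltr_pwDr// ler_norm.
have B0 : 0 <= B' by rewrite addr_ge0.
pose dl := ((2 : R) ^+ n0)^-1.
have d0 : 0 < dl by rewrite invr_gt0 exp2_gt0.
have db0 : 0 < dl `^ beta by exact: powR_gt0.
exists (C + 2 * B' / dl `^ beta) => s t us ut.
rewrite mulrDl; have [st|st] := ltP `|s - t| dl.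
  rewrite (le_trans (hC s t _ _ st)) ?sN// lerDl.
  by rewrite mulr_ge0 ?powR_ge0// divr_ge0 ?mulr_ge0// ltW.
rewrite (@le_trans _ _ (2 * B'))//.
  rewrite (le_trans (ler_normB _ _))//.
  by have := hB' _ us; have := hB' _ ut; lra.
rewrite ler_wpDl// ?mulr_ge0 ?powR_ge0//.
rewrite -[leLHS]mulr1 -[leRHS]mulrA ler_wpM2l ?mulr_ge0// mulrC ler_pdivlMr// mul1r.
by rewrite ge0_ler_powR ?nnegrE ?(ltW b0) ?(ltW d0).
Qed.

(** * Borel-Cantelli and the regular version *)

Lemma nneseries_geometric_lty (R : realType) (a z : R) : 0 <= a -> 0 <= z -> z < 1 ->
  (\sum_(n <oo) (a * z ^+ n)%:E < +oo)%E.
Proof.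
move=> a0 z0 z1.
apply: (@le_lt_trans _ _ (a / (1 - z))%:E); last exact: ltry.
apply: lime_le.
  by apply: is_cvg_nneseries => n _ _; rewrite lee_fin mulr_ge0 ?exprn_ge0.
apply: nearW => n; rewrite sumEFin lee_fin.
rewrite -[leLHS]/(series (geometric a z) n) geometric_seriesE ?lt_eqF//=.
rewrite -mulrA ler_wpM2l// ler_piMl ?invr_ge0 ?subr_ge0 ?(ltW z1)//.
by rewrite gerBl exprn_ge0.
Qed.

Lemma notin_lim_sup_set (T : Type) (F : (set T)^nat) (w : T) :
  ~ lim_sup_set F w -> exists n0 : nat, forall n, (n0 <= n)%N -> ~ F n w.
Proof.
move=> nF; apply: contrapT => h; apply: nF => n _.
apply: contrapT => h'; apply: h; exists n => m nm Fm; apply: h'.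
by exists m.
Qed.

Definition large_increment (R : realType) (T : Type) (q : R) (X : R -> T -> R)
    (n : nat) (j : int) : set T :=
  [set w | q ^+ n < `|X ((j + 1)%:~R / 2 ^+ n) w - X (j%:~R / 2 ^+ n) w|].

(** The shifted index runs over all integers from [- N * 2 ^ n] to [N * 2 ^ n], that is, over the
    level [n] grid points in [[- N, N]]. *)
Definition large_increments (R : realType) (T : Type) (q : R) (X : R -> T -> R)
    (N n : nat) : set T :=
  \big[setU/set0]_(i < (2 * N * 2 ^ n).+1)
     large_increment q X n (i%:Z - (N * 2 ^ n)%:Z).

Lemma notin_large_increments (R : realType) (T : Type) (q : R) (X : R -> T -> R)
    (N n : nat) (w : T) :
  ~ large_increments q X N n w -> dyadic_increments_le q N n (X ^~ w).
Proof.
move=> nA j jN; have {}jN : `|j| <= (N * 2 ^ n)%:Z.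
  by rewrite -(ler_int R) -[leRHS]/((N * 2 ^ n)%:R) natrM natrX.
rewrite leNgt; apply/negP => hj; apply: nA; rewrite /large_increments.
have hi : (`|(j + (N * 2 ^ n)%:Z)%R|%N < (2 * N * 2 ^ n).+1)%N.
  by rewrite ltnS -mulnA; lia.
rewrite -(bigcup_mkord _ (fun i => large_increment q X n (i%:Z - (N * 2 ^ n)%:Z))).
exists `|(j + (N * 2 ^ n)%:Z)%R|%N => //.
have -> : `|(j + (N * 2 ^ n)%:Z)%R|%N%:Z - (N * 2 ^ n)%:Z = j.
  rewrite gez0_abs ?addrK//; lia.
exact: hj.
Qed.

Section continuity_theorem.
Context (d : measure_display) (T : measurableType d) (R : realType)
  (P : probability T R) (X : R -> T -> R) (beta r C : R).
Context (mX : forall t, measurable_fun setT (X t)) (b0 : 0 < beta) (r1 : 1 < r) (C0 : 0 <= C)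
  (hX : forall s h : R, 0 < h -> h <= 1 ->
    (P [set w | (h `^ beta < `|X (s + h) w - X s w|)%R] <= (C * h `^ r)%:E)%E).

Let q := 2 `^ (- beta) : R.

Lemma measurable_large_increments N n : measurable (large_increments q X N n).
Proof.
apply: bigsetU_measurable => i _; apply: measurable_norm_gt.
exact: measurable_funB.
Qed.

Lemma half_itv n : 0 < ((2 : R) ^+ n)^-1 <= 1.
Proof.
by rewrite invr_gt0 exp2_gt0/= invf_le1 ?exp2_gt0// exprn_ege1// ler1n.
Qed.

(** Union bound over [2 * N * 2 ^ n + 1 <= (2 * N + 1) * 2 ^ n] increments, each large with
    probability at most [C * 2 ^ (- r * n)]. *)
Lemma prob_large_increments N n :
  (P (large_increments q X N n)
   <= ((C * (2 * N + 1)%:R) * (2 * 2 `^ (- r)) ^+ n)%:E)%E.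
Proof.
have /andP[p0 p1] := half_itv n.
have h1 j : (P (large_increment q X n j) <= (C * (2 `^ (- r)) ^+ n)%:E)%E.
  have := hX (j%:~R / 2 ^+ n) p0 p1; rewrite -!powR_half /large_increment.
  by rewrite intrD mulrDl div1r.
pose F (i : nat) := large_increment q X n (i%:Z - (N * 2 ^ n)%:Z).
have mF i : measurable (F i) by apply: measurable_norm_gt; exact: measurable_funB.
apply: (le_trans (@Boole_inequality _ _ _ P F _ (fun i _ => mF i))).
apply: le_trans (lee_sum _ (fun i _ => h1 _)) _.
rewrite sumEFin lee_fin sumr_const card_ord -[leLHS]mulr_natr.
rewrite exprMn -!mulrA ler_wpM2l// mulrA mulrC ler_wpM2r ?exprn_ge0 ?powR_ge0//.
rewrite -natrX -natrM ler_nat.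
by have := expn_gt0 2 n; lia.
Qed.

(** Borel-Cantelli: the bounds form a geometric series of ratio [2 ^ (1 - r)], which is below 1
    because [r > 1]. *)
Lemma lim_sup_large_increments N : P (lim_sup_set (large_increments q X N)) = 0%E.
Proof.
apply: lim_sup_set_cvg0; first exact: measurable_large_increments.
apply: le_lt_trans (lee_nneseries _ (fun n _ => prob_large_increments N n)) _.
  by move=> n _.
apply: nneseries_geometric_lty; [exact: mulr_ge0|by rewrite mulr_ge0 ?powR_ge0|].
rewrite -{1}[2]powRr1// -powRD ?pnatr_eq0 ?implybT//.
by rewrite powR2_lt1// subr_lt0.
Qed.

(** One exceptional event for all times at once; the countable union over windows keeps it null. *)
Definition irregular_set := \bigcup_N lim_sup_set (large_increments q X N).

Lemma measurable_irregular_set : measurable irregular_set.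
Proof.
apply: bigcup_measurable => N _; apply: bigcap_measurable => // n _.
by apply: bigcup_measurable => m _; exact: measurable_large_increments.
Qed.

Lemma prob_irregular_set : P irregular_set = 0%E.
Proof.
apply/eqP; rewrite eq_le measure_ge0 andbT.
apply: le_trans (measure_sigma_subadditive _ _ _ (@subset_refl _ _)) _.
- move=> N; apply: bigcap_measurable => // n _.
  by apply: bigcup_measurable => m _; exact: measurable_large_increments.
- exact: measurable_irregular_set.
- by rewrite eseries0// => N _ _; exact: lim_sup_large_increments.
Qed.

Lemma notin_irregular_set w : ~ irregular_set w -> dyadic_regular q (X ^~ w).
Proof.
move=> nw N.
have nl : ~ lim_sup_set (large_increments q X N) w.
  by move=> h; apply: nw; exists N.
have [n0 hn0] := notin_lim_sup_set nl.
by exists n0 => n n0n; apply: notin_large_increments; exact: hn0.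
Qed.

Lemma dyadic_lim_cvg w t : ~ irregular_set w ->
  (fun n => X (dyadic_floor n t) w) @ \oo --> dyadic_lim (X ^~ w) t.
Proof.
move=> /notin_irregular_set hw.
pose N := (Num.truncn (`|t| + 1)).+1.
have tN : `|t| + 1 <= N%:R by rewrite ltW// truncnS_gt.
have [n0 hn0] := hw N.
have q1 : q < 1 by rewrite powR2_lt1// oppr_lt0.
by have [+ _] := dyadic_lim_dist (powR_ge0 _ _) q1 hn0 tN.
Qed.

(** The distance [h] from [t] to its grid point is at most [2 ^- n], so [h ^ beta <= q ^ n] and the
    tail hypothesis applies. If [h = 0], the event is empty. *)
Lemma prob_dyadic_floor_gt t n :
  (P [set w | (q ^+ n < `|X (dyadic_floor n t) w - X t w|)%R]
   <= (C * (2 `^ (- r)) ^+ n)%:E)%E.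
Proof.
have /andP[f1 f2] := dyadic_floor_itv n t.
have /andP[p0 p1] := half_itv n.
have [h0|h0] := eqVneq (dyadic_floor n t) t.
  rewrite (_ : [set w | _] = set0) ?measure0 ?lee_fin ?mulr_ge0 ?exprn_ge0 ?powR_ge0//.
  apply/seteqP; split=> w //=; rewrite h0 subrr normr0 ltNge.
  by rewrite exprn_ge0// powR_ge0.
pose h := t - dyadic_floor n t.
have h_gt0 : 0 < h by rewrite subr_gt0 lt_neqAle h0 f1.
have hn : h <= (2 ^+ n)^-1 by rewrite /h; lra.
have := hX (dyadic_floor n t) h_gt0 (le_trans hn p1); rewrite /h subrKC -/h => hP.
apply: (@le_trans _ _ (C * h `^ r)%:E); last first.
  by rewrite lee_fin powR_half ler_wpM2l// ge0_ler_powR ?nnegrE ?(ltW h_gt0) ?(ltW p0) ?(ltW (lt_trans ltr01 r1)).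
apply: le_trans hP; apply: le_measure; rewrite ?inE.
- by apply: measurable_norm_gt; exact: measurable_funB.
- by apply: measurable_norm_gt; exact: measurable_funB.
move=> w /=; rewrite distrC; apply: le_lt_trans.
by rewrite powR_half ge0_ler_powR ?nnegrE ?(ltW h_gt0) ?(ltW p0) ?(ltW b0).
Qed.

(** A second use of Borel-Cantelli, at a fixed time: almost surely [X] along the grid points tends
    to [X t], and off [irregular_set] it also tends to [dyadic_lim]. The null set may depend on
    [t]. *)
Lemma dyadic_lim_ae t : {ae P, forall w, ~ irregular_set w -> dyadic_lim (X ^~ w) t = X t w}.
Proof.
pose F n := [set w | q ^+ n < `|X (dyadic_floor n t) w - X t w|].
have mF n : measurable (F n) by apply: measurable_norm_gt; exact: measurable_funB.
have PF : P (lim_sup_set F) = 0%E.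
  apply: lim_sup_set_cvg0 => //.
  apply: le_lt_trans (lee_nneseries _ (fun n _ => prob_dyadic_floor_gt t n)) _ => //.
  apply: nneseries_geometric_lty => //.
  by rewrite powR2_lt1// oppr_lt0 (lt_trans ltr01).
exists (lim_sup_set F); split => //.
  apply: bigcap_measurable => // n _.
  by apply: bigcup_measurable => m _; exact: mF.
move=> w /= nw; apply: contrapT => nF; apply: nw => nw.
have [n0 hn0] := notin_lim_sup_set nF.
have lim1 := dyadic_lim_cvg (t := t) nw.
have q1 : q < 1 by rewrite powR2_lt1// oppr_lt0.
have lim2 : (fun n => X (dyadic_floor n t) w) @ \oo --> X t w.
  have qn0 : (fun n => q ^+ n) @ \oo --> (0 : R).
    by apply: cvg_expr; rewrite ger0_norm ?powR_ge0.
  apply/cvgrPdist_lt => e e0; near=> n.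
  apply: (@le_lt_trans _ _ (q ^+ n)).
    rewrite distrC leNgt; apply/negP; apply: hn0.
    by near: n; exact: nbhs_infty_ge.
  have : `|0 - q ^+ n| < e by near: n; exact: cvgr_dist_lt.
  by rewrite sub0r normrN ger0_norm ?exprn_ge0 ?powR_ge0.
exact: cvg_unique lim1 lim2.
Unshelve. all: by end_near. Qed.

(** The indicator replaces each irregular path by the zero path, so that every path is regular. *)
Definition regularized (t : R) (w : T) : R :=
  dyadic_lim (X ^~ w) t * \1_(~` irregular_set) w.

(** A pointwise limit of measurable functions: the indicator makes the approximations converge
    everywhere, being constantly 0 on [irregular_set]. *)
Lemma measurable_regularized t : measurable_fun setT (regularized t).
Proof.
have mZ : measurable (~` irregular_set).
  by apply: measurableC; exact: measurable_irregular_set.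
apply: (measurable_fun_cvg
  (h := fun n w => X (dyadic_floor n t) w * \1_(~` irregular_set) w)).
  by move=> n; apply: measurable_funM => //; exact: measurable_indic.
move=> w _; rewrite /regularized indicE; case: (boolP (w \in _)).
  rewrite inE => nw; apply: cvgMl; exact: dyadic_lim_cvg.
move=> _; rewrite mulr0 /=.
under eq_fun do rewrite mulr0.
exact: cvg_cst.
Qed.

HB.instance Definition _ t :=
  isMeasurableFun.Build _ _ _ _ (regularized t) (measurable_regularized t).

Lemma regularizedE t w : ~ irregular_set w -> regularized t w = dyadic_lim (X ^~ w) t.
Proof. by move=> nw; rewrite /regularized indicE mem_set ?mulr1. Qed.

Lemma regularized0 t w : irregular_set w -> regularized t w = 0.
Proof. by move=> hw; rewrite /regularized indicE memNset ?mulr0. Qed.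

(** Kolmogorov's continuity criterion with a tail bound in place of a moment bound. Regularity holds
    for every [w]; only the agreement with [X] is almost sure. *)
Lemma kolmogorov_continuity : exists Y : R -> {RV P >-> R},
  [/\ forall t, {ae P, forall w, Y t w = X t w},
      forall w, continuous (fun t => Y t w) &
      forall w u v, holder_on beta `[u, v] (fun t => Y t w)].
Proof.
exists (fun t => regularized t : {RV P >-> R}); split => [t|w|w u v].
- have irr0 : {ae P, forall w, ~ irregular_set w}.
    exists irregular_set; split; [exact: measurable_irregular_set|
      exact: prob_irregular_set|by move=> w /= /contrapT].
  apply: filterS2 irr0 (dyadic_lim_ae t) => w nw /(_ nw) <-.
  exact: regularizedE.
- have [hw|hw] := pselect (irregular_set w).
    rewrite (_ : (fun t => _) = cst 0); first exact: cst_continuous.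
    by apply/funext => t; exact: regularized0.
  rewrite (_ : (fun t => _) = dyadic_lim (X ^~ w)).
    exact: dyadic_lim_continuous b0 (notin_irregular_set hw).
  by apply/funext => t; exact: regularizedE.
- have [hw|hw] := pselect (irregular_set w).
    rewrite (_ : (fun t => _) = cst 0); last by apply/funext => t; exact: regularized0.
    by exists 0 => s t _ _; rewrite /= subrr normr0 mul0r.
  rewrite (_ : (fun t => _) = dyadic_lim (X ^~ w)).
    exact: dyadic_lim_holder b0 (notin_irregular_set hw).
  by apply/funext => t; exact: regularizedE.
Qed.

End continuity_theorem.

(** * Hölder paths of the tempered multistable motion *)

Theorem proposition11 (d : measure_display) (T : measurableType d)
    (R : realType) (P : probability T R)
    (a b : R) (ha : 1 < a) (hab : a <= b) (hb : b <= 2)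
    (alpha : R -> R) (halpha : forall x, a <= alpha x <= b)
    (calpha : continuous alpha)
    (H : R) (hH0 : 0 < H) (hH1 : H < 1) (hHa : 1 < H * a)
    (lambda : R) (hlambda : 0 < lambda)
    (I : (R -> R) -> {RV P >-> R}) (hI : is_multistable_integral alpha I)
    (beta : R) (hbeta0 : 0 < beta) (hbeta : beta < H - a^-1) :
  exists Y : R -> {RV P >-> R},
    [/\ is_version (LTFmSM I H alpha lambda) Y,
        forall w : T, continuous (fun t => Y t w)
      & {ae P, forall w, forall u v : R,
          holder_on beta `[u, v] (fun t => Y t w)}].
Proof.
have a0 : 0 < a by rewrite (lt_trans ltr01).
have ai : 0 < a^-1 by rewrite invr_gt0.
have bH : beta < H by lra.
(* The assumption [beta < H - 1 / a], multiplied by [a], is the summability condition of the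
   criterion. *)
have r1 : 1 < (H - beta) * a by rewrite -ltr_pdivrMr// div1r; lra.
have [C C0 hC] :=
  LTFmSM_increment_tail ha hb halpha calpha hH0 hH1 hHa (ltW hlambda) hI bH.
have mX t : measurable_fun setT (LTFmSM I H alpha lambda t : T -> R) by [].
have [Y [hY cY hoY]] := kolmogorov_continuity mX hbeta0 r1 C0 hC.
by exists Y; split => //; apply: nearW.
Qed.
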